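(* Let $T\in\mathcal{T}$ have a (Lebesgue) density $f_T$, and let $H_0$ be the function associated with $X_0=\varphi^{-1}(T)$, that is, $H_0(y)=G_0(1-e^{-y})$, $y>0$, where $G_0$ is the inverse distribution function of $X_0$. Then $$H_0(y)=\int_1^y\frac{e^x}{x}f_T(x)\,dx+\int_0^1\frac{e^t-1}{t}f_T(t)\,dt-\int_1^\infty\frac1tf_T(t)\,dt,\qquad y>0.$$ Moreover, the random variable $X_0=\varphi^{-1}(T)$ has a continuous distribution function if $f_T(y)>0$ for almost all $y>0$.
   Context: $\mathcal{T}$ is the set of all random variables $T$ with $\Pr(T>0)=1$ and finite moments of every order; identically distributed random variables are regarded as equal. Inverse distribution functions are left-continuous: $F^{-1}(u)=\inf\{x:F(x)\ge u\}$, $0<u<1$. For $T\in\mathcal{T}$ with distribution function $F_T$, $\varphi^{-1}(T)$ (also denoted $\varphi'(T)$) is the random variable whose inverse distribution function $G_0$ is given by $G_0(1-e^{-y})=H_0(y)$, $y>0$, where $$H_0(y)=\frac{e^y}{y}F_T(y-)-\int_1^y\frac{x-1}{x^2}e^xF_T(x)\,dx-c_T,\qquad y>0,$$ $F_T(y-)=\Pr(T<y)$, and $c_T$ is the unique constant (depending only on $T$) for which $\int_0^\infty e^{-y}H_0(y)\,dy=0$. Throughout, $\int_1^y=-\int_y^1$ if $0<y<1$. *)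

(* Defs.v *)
From mathcomp Require Import all_boot all_order all_algebra.
From mathcomp Require Import all_classical all_reals all_analysis.
Set Implicit Arguments.
Unset Strict Implicit.
Unset Printing Implicit Defensive.
Import Order.TTheory GRing.Theory Num.Theory.
Import numFieldNormedType.Exports.
Local Open Scope classical_set_scope.
Local Open Scope ring_scope.

Definition class_T d (Omega : measurableType d) (R : realType)
    (P : probability Omega R) (T : {RV P >-> R}) : Prop :=
  P [set w | 0 < T w] = 1%E /\
  forall n : nat, P.-integrable setT (fun w => (T w ^+ n)%:E).

Definition is_density d (Omega : measurableType d) (R : realType)
    (P : probability Omega R) (T : {RV P >-> R}) (f : R -> R) : Prop :=
  [/\ measurable_fun setT f,
      forall x, 0 <= f x &
      forall A : set R, measurable A ->
        distribution P T A = (\int[lebesgue_measure]_(x in A) (f x)%:E)%E].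

Definition inverse_df (R : realType) (F : R -> \bar R) (u : R) : R :=
  inf [set x | (u%:E <= F x)%E].

Definition oriented_int (R : realType) (a b : R) (g : R -> R) : R :=
  if a <= b then \int[lebesgue_measure]_(x in `[a, b]) g x
  else - \int[lebesgue_measure]_(x in `[b, a]) g x.

Section PhiInverse.
Context d (Omega : measurableType d) (R : realType).
Context (P : probability Omega R) (T : {RV P >-> R}).

Definition H0_uncentered (y : R) : R :=
  expR y / y * fine (P [set w | T w < y])
  - oriented_int 1 y (fun x => (x - 1) / x ^+ 2 * expR x * fine (cdf T x)).

(* The integral is extended-real valued, so that equating it with 0 entails
   that the integrand is integrable. *)
Definition is_centering (c : R) : Prop :=
  (\int[lebesgue_measure]_(y in `]0%R, +oo[)
     (expR (- y) * (H0_uncentered y - c))%:E = 0)%E.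

Definition centering : R := get is_centering.

Definition H0 (y : R) : R := H0_uncentered y - centering.

(* Random variables are identified with their laws, so phi^{-1}(T) is a law.
   The inverse distribution function determines it on Borel sets; if no law
   had the required one, [get] would return an unrelated default law. *)
Definition phi_inv : probability R R :=
  get [set mu : probability R R |
    forall y : R, 0 < y ->
      inverse_df (fun x => mu `]-oo, x]%classic) (1 - expR (- y)) = H0 y].

End PhiInverse.

Definition has_law d (Omega : measurableType d) (R : realType)
    (Q : probability Omega R) (X : {RV Q >-> R})
    (mu : probability R R) : Prop :=
  forall A : set R, measurable A -> distribution Q X A = mu A.

(* Main.v *)
Require Import Defs.
From mathcomp Require Import all_boot all_order all_algebra.
From mathcomp Require Import all_classical all_reals all_analysis.
From mathcomp Require Import measurable_realfun ring lra.
Import Order.TTheory GRing.Theory Num.Theory.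
Import numFieldNormedType.Exports.
Local Open Scope classical_set_scope.
Local Open Scope ring_scope.
Set Implicit Arguments.
Unset Strict Implicit.
Unset Printing Implicit Defensive.

(** Write F for the distribution function of T, h(x) = e^x / x, and
J(y) = int_1^y h(x) f(x) dx for the oriented integral.

The weight in the definition of H_0 is h', so H_0 is, before centering, the
boundary term h(y) F(y) minus int_1^y h' F.  Integration by parts turns this
into e F(1) + J(y).  Since F is only the primitive of an integrable function,
the integration by parts is done as an exchange of the order of integration
over the triangle t <= x ([tonelli_triangle], [Rintegral_by_parts_ge0]); it
is carried out on each side of 1, where h' has a constant sign
([H0_uncenteredE]).

The centering constant is the mean of e F(1) + J under the standard
exponential law.  A second exchange over a triangle, separately on ]0, 1] and
on [1, +oo[, computes the mean of J as
int_1^oo e^{-t} h f - int_0^1 (1 - e^{-t}) h f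
([integrable_expRN_oriented_int]).  Subtracting it gives the stated formula
for H_0 ([H0_density]).

It remains to see that H_0 really is the inverse distribution function of
X_0.  J is continuous and nondecreasing on ]0, +oo[, so the law of H_0(E),
with E standard exponential, has inverse distribution function
1 - e^{-y} |-> H_0(y) ([inverse_df_law_exists]), and phi_inv T is then a law
with this property.

A jump of the distribution function of X_0 would be an interval of levels on
which the inverse distribution function is constant ([cdf_continuous]).  If
f > 0 almost everywhere on ]0, +oo[, then J is increasing
([oriented_int_increasing]), so there is no jump. *)

(** * Integrability of real-valued functions *)

Section integrability.
Context d (T : measurableType d) (R : realType) (mu : {measure set T -> \bar R}).

Lemma ge0_integrable (A : set T) (f : T -> \bar R) : measurable A ->
  measurable_fun A f -> (forall x, A x -> 0 <= f x)%E ->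
  (\int[mu]_(x in A) f x < +oo)%E -> mu.-integrable A f.
Proof.
move=> mA mf f0 foo; apply/integrableP; split => //.
rewrite (eq_integral f)// => x /set_mem Ax; exact: gee0_abs (f0 x Ax).
Qed.

Lemma integrable_setU (A B : set T) (f : T -> \bar R) :
  measurable A -> measurable B -> [disjoint A & B] ->
  mu.-integrable A f -> mu.-integrable B f -> mu.-integrable (A `|` B) f.
Proof.
move=> mA mB AB /integrableP[mfA iA] /integrableP[mfB iB].
have mf : measurable_fun (A `|` B) f by apply/measurable_funU.
apply/integrableP; split => //.
rewrite ge0_integral_setU//; last exact: measurableT_comp.
exact: lte_add_pinfty.
Qed.

Lemma integrable_EFinZl (A : set T) (c : R) (f : T -> R) : measurable A ->
  mu.-integrable A (EFin \o f) -> mu.-integrable A (EFin \o (fun t => c * f t)).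
Proof. by move=> mA fi; apply: eq_integrable (integrableZl mA c fi). Qed.

Lemma integrable_EFinB (A : set T) (f g : T -> R) : measurable A ->
  mu.-integrable A (EFin \o f) -> mu.-integrable A (EFin \o g) ->
  mu.-integrable A (EFin \o (fun t => f t - g t)).
Proof. by move=> mA fi gi; apply: eq_integrable (integrableB mA fi gi). Qed.

Lemma integrable_EFinM_bounded (A : set T) (w f : T -> R) (C : R) :
  measurable A -> measurable_fun A w -> (forall x, A x -> 0 <= w x <= C) ->
  mu.-integrable A (EFin \o f) ->
  mu.-integrable A (EFin \o (fun t => w t * f t)).
Proof.
move=> mA mw wC fi.
have mf : measurable_fun A f by apply/measurable_EFinP; exact: measurable_int fi.
apply: (le_integrable mA _ _ (integrable_EFinZl C mA fi)).
  by apply/measurable_EFinP; exact: measurable_funM.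
move=> x Ax /=; have /andP[w0 wle] := wC x Ax.
by rewrite lee_fin !normrM ler_wpM2r// !ger0_norm// (le_trans w0).
Qed.

End integrability.

(** * Exchange of integrals over a triangle *)

Section triangle.
Context {R : realType}.
Notation mu := (@lebesgue_measure R).

(** Both sides of the exchange below are put in this form, an integral over the
whole line of an integrand cut off by a membership test, so that they become
the two iterated integrals of one function of two variables. *)
Lemma ge0_scale_integral_setI (psi : R -> R) (B S : set R) (c : R) :
  measurable B -> measurable S -> measurable_fun B psi ->
  (forall t, B t -> 0 <= psi t) -> 0 <= c ->
  (c%:E * \int[mu]_(t in B `&` S) (psi t)%:E =
   \int[mu]_t (if t \in S then (c * (psi \_ B) t)%:E else 0))%E.
Proof.
move=> mB mS mpsi psi0 c0.
rewrite -ge0_integralZl_EFin//; last 3 first.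
- exact: measurableI.
- by move=> t [Bt _]; rewrite lee_fin psi0.
- by apply/measurable_EFinP; apply: measurable_funS mpsi => //; exact: subIsetl.
rewrite integral_mkcond; apply: eq_integral => t _.
rewrite !patchE in_setI andbC; case: (t \in S) => //=.
by case: (t \in B) => //; rewrite mulr0.
Qed.

(** Tonelli's theorem on the part of A x B where t <= x.  It serves three times:
for the integration by parts, and for the exponential mean of an oriented
integral on either side of 1. *)
Lemma tonelli_triangle (phi psi : R -> R) (A B : set R) :
  measurable A -> measurable B ->
  measurable_fun A phi -> measurable_fun B psi ->
  (forall x, A x -> 0 <= phi x) -> (forall t, B t -> 0 <= psi t) ->
  (\int[mu]_(x in A) ((phi x)%:E *
      \int[mu]_(t in B `&` `]-oo, x]) (psi t)%:E) =
   \int[mu]_(t in B) ((psi t)%:E *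
      \int[mu]_(x in A `&` `[t, +oo[) (phi x)%:E))%E.
Proof.
move=> mA mB mphi mpsi phi0 psi0.
(* The restrictions to A and B make k nonnegative and measurable everywhere. *)
pose k (z : R * R) : \bar R :=
  if z.2 <= z.1 then ((phi \_ A) z.1 * (psi \_ B) z.2)%:E else 0%E.
have p0 x : 0 <= (phi \_ A) x.
  by rewrite patchE; case: ifPn => // /set_mem; exact: phi0.
have q0 x : 0 <= (psi \_ B) x.
  by rewrite patchE; case: ifPn => // /set_mem; exact: psi0.
have mp := (measurable_restrictT phi mA).1 mphi.
have mq := (measurable_restrictT psi mB).1 mpsi.
have mk : measurable_fun setT k.
  apply: measurable_fun_ifT => //.
  - exact: (measurable_fun_ler measurable_snd measurable_fst).
  - apply/measurable_EFinP; apply: measurable_funM.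
      exact: (measurableT_comp mp measurable_fst).
    exact: (measurableT_comp mq measurable_snd).
have k0 z : (0 <= k z)%E.
  by rewrite /k; case: ifP => // _; rewrite lee_fin mulr_ge0.
rewrite integral_mkcond [RHS]integral_mkcond.
transitivity (\int[mu]_x \int[mu]_t k (x, t))%E.
  apply: eq_integral => x _; rewrite patchE; case: ifPn => [/set_mem Ax|xA].
    rewrite ge0_scale_integral_setI ?phi0//; apply: eq_integral => t _.
    by rewrite /k/= mem_setE in_itv/= [(phi \_ A) x]patchE mem_set.
  rewrite integral0_eq// => t _.
  by rewrite /k/= patchE (negbTE xA) mul0r; case: ifP.
have -> := fubini_tonelli (m1 := mu) (m2 := mu) k mk k0.
apply: eq_integral => t _; rewrite patchE; case: ifPn => [/set_mem Bt|tB].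
  rewrite ge0_scale_integral_setI ?psi0//; apply: eq_integral => x _.
  by rewrite /k/= mem_setE in_itv/= andbT [(psi \_ B) t]patchE mem_set// mulrC.
rewrite integral0_eq// => x _.
by rewrite /k/= [(psi \_ B) t]patchE (negbTE tB) mulr0; case: ifP.
Qed.

End triangle.

(** * Integration by parts against a cumulative function *)

Section weight.
Context {R : realType}.
Notation mu := (@lebesgue_measure R).

Lemma is_derive_expRV (c x : R) : 0 < x ->
  is_derive x 1 (fun y : R => c * (expR y / y)) (c * ((x - 1) / x ^+ 2 * expR x)).
Proof.
move=> x0; have xn0 : x != 0 by rewrite gt_eqF.
have dV := @is_deriveV R id x 1 1 xn0 (is_derive_id x 1).
have dF := is_deriveZ c (is_deriveM (is_derive_expR x) dV).
apply: (is_derive_eq dF).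
rewrite /GRing.scale/=.
by field.
Qed.

Lemma continuous_expRV_deriv (x : R) : 0 < x ->
  {for x, continuous (fun y : R => (y - 1) / y ^+ 2 * expR y)}.
Proof.
move=> x0; have xn0 : x != 0 by rewrite gt_eqF.
apply: cvgM; last exact: continuous_expR.
apply: cvgM; first by apply: cvgB => //; exact: cvg_cst.
apply: cvgV; first by rewrite expf_neq0.
exact: exprn_continuous.
Qed.

(** The factor c is there for the values 1 and -1: the derivative of e^x / x is
negative below 1, and the integration by parts needs a nonnegative one. *)
Lemma integral_expRV (c a b : R) : 0 < a -> a <= b ->
  (\int[mu]_(x in `[a, b]) (c * ((x - 1) / x ^+ 2 * expR x))%:E =
   (c * (expR b / b) - c * (expR a / a))%:E)%E.
Proof.
move=> a0; rewrite le_eqVlt => /predU1P[<-|ab].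
  by rewrite set_itv1 integral_set1 subrr.
have pos x : a <= x -> 0 < x by exact: lt_le_trans.
have cF x : 0 < x -> {for x, continuous (fun y : R => c * (expR y / y))}.
  move=> x0; apply/differentiable_continuous/derivable1_diffP.
  by have [] := is_derive_expRV c x0.
rewrite (@continuous_FTC2 _ _ (fun y : R => c * (expR y / y))) ?EFinB//.
- apply: continuous_in_subspaceT => x; rewrite inE/= in_itv/= => /andP[ax _].
  apply: cvgM; first exact: cvg_cst.
  by apply: continuous_expRV_deriv; rewrite pos.
- split => [x| |].
  + rewrite in_itv/= => /andP[ax _].
    by have [] := is_derive_expRV c (pos x (ltW ax)).
  + exact/cvg_at_right_filter/cF.
  + by apply/cvg_at_left_filter/cF; rewrite (lt_trans a0).
- move=> x; rewrite in_itv/= => /andP[ax _].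
  by rewrite derive1E; have [_ ->] := is_derive_expRV c (pos x (ltW ax)).
Qed.

End weight.

Section by_parts.
Context {R : realType}.
Notation mu := (@lebesgue_measure R).
Variables (f H g : R -> R) (a b : R).
Hypothesis f0 : forall x, 0 <= f x.
Hypothesis fi : mu.-integrable setT (EFin \o f).
Hypothesis ab : a <= b.
Hypothesis mg : measurable_fun `[a, b] g.
Hypothesis g0 : forall x, a <= x <= b -> 0 <= g x.
Hypothesis gH : forall t, a <= t -> t <= b ->
  (\int[mu]_(x in `[t, b]) (g x)%:E = (H b - H t)%:E)%E.
Hypothesis Hfi : mu.-integrable `[a, b] (EFin \o (H \* f)).

Let F x := \int[mu]_(t in `]-oo, x]) f t.

(** The fundamental theorem of calculus does not apply to F, which need not be
differentiable; instead, g(x) F(x) is the integral of g(x) f(t) over t <= x.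
Integrating in x first gives (H b - H a) f(t) for t <= a and
(H b - H t) f(t) for t in ]a, b], and the latter splits into the boundary
terms and the integral of H f.  Integrating in x from t to b is all that is
asked of H and g, which is why [gH] mentions no derivative. *)
Lemma Rintegral_by_parts_ge0 :
  \int[mu]_(x in `[a, b]) (g x * F x) =
  H b * F b - H a * F a - \int[mu]_(x in `[a, b]) (H x * f x).
Proof.
have mf : measurable_fun setT f by apply/measurable_EFinP; exact: measurable_int fi.
have fiS (A : set (measurableTypeR R)) : measurable A -> mu.-integrable A (EFin \o f).
  by move=> mA; exact: integrableS fi.
have cfi c (A : set (measurableTypeR R)) : measurable A ->
    mu.-integrable A (EFin \o (fun t => c * f t)).
  by move=> mA; apply: integrable_EFinZl => //; exact: fiS.
have FE x : (F x)%:E = (\int[mu]_(t in `]-oo, x]) (f t)%:E)%E.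
  by rewrite /F /Rintegral fineK//; exact: integrable_fin_num (fiS _ _).
have := @tonelli_triangle _ g f `[a, b] `]-oo, b] (measurable_itv _)
  (measurable_itv _) mg (measurable_funS measurableT (@subsetT _ _) mf) _ _.
have -> : (\int[mu]_(x in `[a, b]) ((g x)%:E *
      \int[mu]_(t in `]-oo, b] `&` `]-oo, x]) (f t)%:E) =
    \int[mu]_(x in `[a, b]) (g x * F x)%:E)%E.
  apply: eq_integral => x; rewrite inE/= in_itv/= => /andP[_ xb].
  rewrite EFinM FE; congr (_ * integral _ _ _)%E.
  by apply: setIidr; apply: subset_itvl; rewrite bnd_simp.
have inner t : a <= t -> t <= b ->
    (\int[mu]_(x in `[a, b] `&` `[t, +oo[) (g x)%:E = (H b - H t)%:E)%E.
  move=> at_ tb; rewrite -gH//; congr (integral _ _ _).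
  apply/seteqP; split => x /=; rewrite !in_itv/= !andbT.
    by move=> [/andP[_ ->] ->].
  by move=> /andP[tx ->]; rewrite (le_trans at_ tx).
have innera t : t <= a ->
    (\int[mu]_(x in `[a, b] `&` `[t, +oo[) (g x)%:E = (H b - H a)%:E)%E.
  move=> ta; rewrite -gH//; congr (integral _ _ _).
  apply: setIidl => x /=; rewrite !in_itv/= !andbT => /andP[ax _].
  exact: le_trans ax.
have iHf : mu.-integrable `]a, b] (EFin \o (fun t => H b * f t - H t * f t)).
  have Hf : mu.-integrable `]a, b] (EFin \o (fun t => H t * f t)).
    by apply: integrableS Hfi => //; exact: subset_itv_oc_cc.
  by apply: integrable_EFinB => //; exact: cfi.
have left_part : {in `]-oo, a]%classic, forall t, ((f t)%:E *
    \int[mu]_(x in `[a, b] `&` `[t, +oo[) (g x)%:E)%E = ((H b - H a) * f t)%:E}.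
  by move=> t; rewrite inE/= in_itv/= => ta; rewrite innera// mulrC EFinM.
have right_part : {in `]a, b]%classic, forall t, ((f t)%:E *
    \int[mu]_(x in `[a, b] `&` `[t, +oo[) (g x)%:E)%E = (H b * f t - H t * f t)%:E}.
  move=> t; rewrite inE/= in_itv/= => /andP[/ltW at_ tb].
  by rewrite inner// -mulrBl mulrC EFinM.
have -> : `]-oo, b]%classic = `]-oo, a] `|` `]a, b].
  by rewrite -itv_bndbnd_setU// bnd_simp.
rewrite ge0_integral_setU//=; last 3 first.
- apply/measurable_funU => //; split.
    apply: (eq_measurable_fun (fun t => ((H b - H a) * f t)%:E)).
      by move=> t ta; rewrite left_part.
    apply/measurable_EFinP; apply: measurable_funM => //.
    exact: measurable_funS mf.
  apply: (eq_measurable_fun (fun t => (H b * f t - H t * f t)%:E)).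
    by move=> t ta; rewrite right_part.
  exact: measurable_int iHf.
- move=> t _; apply: mule_ge0; first by rewrite lee_fin.
  apply: integral_ge0 => x /=; rewrite !in_itv/= => -[abx _].
  by rewrite lee_fin g0.
- apply/disj_setPS => y [/=]; rewrite 2!in_itv/= => ya /andP[].
  by rewrite ltNge ya.
rewrite [X in (_ = X + _)%E](_ : _ =
  (\int[mu]_(t in `]-oo, a]) ((H b - H a) * f t)%:E)%E); last first.
  by apply: eq_integral => t ta; rewrite left_part.
rewrite [X in (_ = _ + X)%E](_ : _ =
  (\int[mu]_(t in `]a, b]) (H b * f t - H t * f t)%:E)%E); last first.
  by apply: eq_integral => t ta; rewrite right_part.
move=> tri; have {}tri := tri _ (fun t _ => f0 t).
rewrite /Rintegral tri; last by move=> x; rewrite in_itv/=; exact: g0.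
rewrite fineD; last 2 first.
- exact: integrable_fin_num (cfi _ _ _).
- exact: integrable_fin_num iHf.
rewrite -!/(Rintegral _ _ _) RintegralZl ?fiS// -/(F a).
rewrite RintegralB//; last 2 first.
- exact: cfi.
- by apply: integrableS Hfi => //; exact: subset_itv_oc_cc.
rewrite RintegralZl ?fiS// -(@Rintegral_itvB _ f -oo%O (BRight b) a) ?bnd_simp//; last exact: fiS.
rewrite -/(F a) -/(F b) (Rintegral_itv_obnd_cbnd (f := H \* f)); last first.
  by apply: integrableS Hfi => //; exact: subset_itv_oc_cc.
by rewrite /=; ring.
Qed.

End by_parts.

(** * Oriented primitives on the positive half-line *)

Section oriented.
Context {R : realType}.
Notation mu := (@lebesgue_measure R).
Variable k : R -> R.
Hypothesis ik : forall a b : R, 0 < a -> mu.-integrable `[a, b] (EFin \o k).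

Lemma Rintegral_chasles (a c b : R) : 0 < a -> a <= c -> c <= b ->
  \int[mu]_(x in `[a, b]) k x =
  \int[mu]_(x in `[a, c]) k x + \int[mu]_(x in `[c, b]) k x.
Proof.
move=> a0 ac cb; rewrite addrC; apply/eqP; rewrite -subr_eq; apply/eqP.
rewrite (Rintegral_itvB (ik b a0)) ?bnd_simp//.
apply: Rintegral_itv_obnd_cbnd.
by apply: integrableS (ik b (lt_le_trans a0 ac)) => //; exact: subset_itv_oc_cc.
Qed.

(** Differences of the primitive based at 1 are plain integrals; continuity and
monotonicity are read off from this identity. *)
Lemma oriented_intB (a b : R) : 0 < a -> a <= b ->
  oriented_int 1 b k - oriented_int 1 a k = \int[mu]_(x in `[a, b]) k x.
Proof.
move=> a0 ab; rewrite /oriented_int; case: ifPn => b1; case: ifPn => a1.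
- by rewrite (Rintegral_chasles ltr01 a1 ab) addrC addKr.
- move: a1; rewrite -ltNge => a1.
  by rewrite opprK (Rintegral_chasles a0 (ltW a1) b1) addrC.
- by move: b1; rewrite (le_trans a1 ab).
- move: b1; rewrite -ltNge => b1; rewrite opprK.
  by rewrite (Rintegral_chasles a0 ab (ltW b1)) addrC addrK.
Qed.

(** Only a segment around y inside ]0, +oo[ matters, and there k is integrable;
k may fail to be integrable at 0. *)
Lemma oriented_int_continuous (y : R) : 0 < y ->
  {for y, continuous (fun x => oriented_int 1 x k)}.
Proof.
move=> y0; pose a := y / 2; pose b := y + 1.
have a0 : 0 < a by rewrite /a; lra.
have ab : a < b by rewrite /a /b; lra.
have /(continuous_within_itvP _ ab)[cab _ _] :
    {within `[a, b], continuous (fun x => oriented_int 1 x k)}.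
  have cf : {within `[a, b], continuous (fun x => oriented_int 1 a k +
    \int[mu]_(t in `[a, x]) k t)}.
    move=> x; apply: cvgD; first exact: cvg_cst.
    exact: (parameterized_integral_continuous (ltW ab) (ik b a0)).
  apply: subspace_eq_continuous cf => x; rewrite inE/= in_itv/= => /andP[ax _].
  by rewrite /from_subspace -oriented_intB// addrC subrK.
by apply: cab; rewrite in_itv/= /a /b; apply/andP; split; lra.
Qed.

Hypothesis k0 : forall x, 0 < x -> 0 <= k x.

Lemma oriented_int_nondecreasing (a b : R) : 0 < a -> a <= b ->
  oriented_int 1 a k <= oriented_int 1 b k.
Proof.
move=> a0 ab; rewrite -subr_ge0 oriented_intB//; apply: Rintegral_ge0 => x.
by rewrite /= in_itv/= => /andP[ax _]; rewrite k0// (lt_le_trans a0 ax).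
Qed.

(** If the two values agreed, k would integrate to 0 on [a, b], hence vanish
almost everywhere on a segment of positive length. *)
Lemma oriented_int_increasing (a b : R) :
  {ae mu, forall y : R, 0 < y -> 0 < k y} ->
  0 < a -> a < b -> oriented_int 1 a k < oriented_int 1 b k.
Proof.
move=> kpos a0 ab; rewrite lt_neqAle oriented_int_nondecreasing// 1?ltW//.
rewrite andbT; apply/negP => /eqP eqJ.
have mk := measurable_int _ (ik b a0).
have kz : ae_eq mu `[a, b]%classic (EFin \o k) (cst 0%E).
  apply/(ae_eq_integral_abs _ _ mk) => //.
  transitivity (\int[mu]_(x in `[a, b]) k x)%:E; last first.
    by rewrite -oriented_intB// 1?ltW// eqJ subrr.
  rewrite /Rintegral fineK; last exact: integrable_fin_num (ik b a0).
  apply: eq_integral => x; rewrite inE/= in_itv/= => /andP[ax _].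
  by rewrite ger0_norm// k0// (lt_le_trans a0 ax).
have [N [mN N0 sN]] : {ae mu, forall x : R, ~ (`[a, b]%classic x)}.
  move: kpos kz; apply: (@filterS2 _ _ (ae_filter_ringOfSetsType mu)) => x kx0 kx abx.
  have := kx abx; move=> -[kx1]; move: abx; rewrite /= in_itv/= => /andP[ax _].
  by have := kx0 (lt_le_trans a0 ax); rewrite kx1 ltxx.
have : (mu `[a, b]%classic <= mu N)%E.
  by apply: le_measure; rewrite ?inE// => x abx; apply: sN => /=; exact.
rewrite N0 lebesgue_measure_itv/= lte_fin ab -EFinB lee_fin.
by rewrite leNgt subr_gt0 ab.
Qed.

End oriented.

(** * Exponential mean of an oriented primitive *)

Section exponential_integrals.
Context {R : realType}.
Notation mu := (@lebesgue_measure R).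

Lemma is_derive_NexpRN (x : R) :
  is_derive x 1 (fun y : R => - expR (- y)) (expR (- x)).
Proof.
have dN := is_deriveN (is_derive_id x (1 : R)).
have dE : is_derive (- x) 1 (@expR R) (expR (- x)) by exact: is_derive_expR.
have dF := is_deriveN (is_derive1_comp dE dN).
by apply: (is_derive_eq dF); rewrite mulrN1 opprK.
Qed.

Lemma continuous_expRN : continuous (fun y : R => expR (- y)).
Proof.
move=> x; apply: continuous_comp; last exact: continuous_expR.
exact: opp_continuous.
Qed.

Lemma integral_expRN_bndy (t : R) :
  (\int[mu]_(y in `[t, +oo[) (expR (- y))%:E = (expR (- t))%:E)%E.
Proof.
rewrite (@ge0_continuous_FTC2y _ _ (fun y : R => - expR (- y)) _ 0) //.
- by rewrite -EFinB sub0r opprK.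
- by apply: continuous_subspaceT; exact: continuous_expRN.
- rewrite -[X in _ --> X]oppr0; apply: cvgN; exact: cvgr_expR.
- by apply: cvg_at_right_filter; apply: cvgN; exact: continuous_expRN.
- by move=> x _; rewrite derive1E; have [_ ->] := is_derive_NexpRN x.
Qed.

Lemma integral_expRN_0x (x : R) : 0 < x ->
  (\int[mu]_(y in `]0%R, x]) (expR (- y))%:E = (1 - expR (- x))%:E)%E.
Proof.
move=> x0; rewrite integral_itv_obnd_cbnd; last first.
  apply/measurable_EFinP; apply: measurable_funTS; apply: continuous_measurable_fun.
  exact: continuous_expRN.
rewrite (@continuous_FTC2 _ _ (fun y : R => - expR (- y))) //.
- by rewrite -EFinB !opprK oppr0 expR0 addrC.
- by apply: continuous_subspaceT; exact: continuous_expRN.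
- split.
  + by move=> y _; have [] := is_derive_NexpRN y.
  + by apply: cvg_at_right_filter; apply: cvgN; exact: continuous_expRN.
  + by apply: cvg_at_left_filter; apply: cvgN; exact: continuous_expRN.
- by move=> y _; rewrite derive1E; have [_ ->] := is_derive_NexpRN y.
Qed.

End exponential_integrals.

Section exponential_average.
Context {R : realType}.
Notation mu := (@lebesgue_measure R).
Variable k : R -> R.
Hypothesis k0 : forall x, 0 < x -> 0 <= k x.
Hypothesis ik : forall a b : R, 0 < a -> mu.-integrable `[a, b] (EFin \o k).
Hypothesis mk : measurable_fun (`]0%R, +oo[ : set R) k.

Local Notation J := (fun y => oriented_int 1 y k).

Hypothesis ik1 : mu.-integrable `[1%R, +oo[ (EFin \o (fun t => expR (- t) * k t)).
Hypothesis ik0 : mu.-integrable `]0%R, 1%R] (EFin \o (fun t => (1 - expR (- t)) * k t)).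

Let J1 : J 1 = 0.
Proof. by rewrite /oriented_int lexx set_itv1 Rintegral_set1. Qed.

Let mJ : measurable_fun (`]0%R, +oo[ : set R) J.
Proof.
apply: open_continuous_measurable_fun; first exact: interval_open.
by move=> y; rewrite inE/= in_itv/= andbT; exact: oriented_int_continuous.
Qed.

Let sub1 : `[1%R, +oo[ `<=` (`]0%R, +oo[ : set R).
Proof. by move=> x /=; rewrite !in_itv/= !andbT; exact: lt_le_trans. Qed.

Let sub0 : `]0%R, 1%R] `<=` (`]0%R, +oo[ : set R).
Proof. exact: subset_itvl. Qed.

Let mE A : measurable_fun A (fun y : R => expR (- y)).
Proof.
by apply: measurable_funTS; apply: continuous_measurable_fun; exact: continuous_expRN.
Qed.

(** For t >= 1 the value k(t) enters J(y) for all y >= t, which have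
exponential mass e^{-t}. *)
Lemma integral_expRN_oriented_int_ge1 :
  (\int[mu]_(y in `[1%R, +oo[) (expR (- y) * J y)%:E =
   \int[mu]_(t in `[1%R, +oo[) (expR (- t) * k t)%:E)%E.
Proof.
transitivity (\int[mu]_(y in `[1%R, +oo[) ((expR (- y))%:E *
    \int[mu]_(t in `[1%R, +oo[ `&` `]-oo, y]) (k t)%:E))%E.
  apply: eq_integral => y; rewrite inE/= in_itv/= andbT => y1.
  rewrite EFinM; congr (_ * _)%E; rewrite /oriented_int y1 /Rintegral fineK.
    congr (integral _ _ _); apply/seteqP; split => x /=; rewrite !in_itv/= !andbT.
      by move=> /andP[-> ->].
    by move=> [-> ->].
  exact: integrable_fin_num (ik y ltr01).
rewrite tonelli_triangle//; last 2 first.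
- by apply: measurable_funS mk.
- by move=> t /sub1/=; rewrite in_itv/= andbT; exact: k0.
apply: eq_integral => t; rewrite inE/= in_itv/= andbT => t1.
rewrite mulrC EFinM; congr (_ * _)%E; rewrite -integral_expRN_bndy.
congr (integral _ _ _); apply: setIidr => x /=; rewrite !in_itv/= !andbT.
exact: le_trans.
Qed.

(** For t <= 1 the value k(t) enters - J(y) for all y <= t, which have
exponential mass 1 - e^{-t}. *)
Lemma integral_expRN_oriented_int_le1 :
  (\int[mu]_(y in `]0%R, 1%R]) (expR (- y) * - J y)%:E =
   \int[mu]_(t in `]0%R, 1%R]) ((1 - expR (- t)) * k t)%:E)%E.
Proof.
transitivity (\int[mu]_(y in `]0%R, 1%R]) ((expR (- y))%:E *
    \int[mu]_(t in `]0%R, 1%R] `&` `[y, +oo[) (k t)%:E))%E.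
  apply: eq_integral => y; rewrite inE/= in_itv/= => /andP[y0 y1].
  rewrite EFinM; congr (_ * _)%E.
  have -> : (J y : R) = - \int[mu]_(t in `[y, 1]) k t.
    by rewrite -(oriented_intB ik y0 y1) J1 sub0r opprK.
  rewrite opprK /Rintegral fineK.
    congr (integral _ _ _); apply/seteqP; split => x /=; rewrite !in_itv/= !andbT.
      by move=> /andP[yx ->]; rewrite yx (lt_le_trans y0 yx).
    by move=> [/andP[_ ->] ->].
  exact: integrable_fin_num (ik 1 y0).
rewrite -tonelli_triangle//; last 2 first.
- by apply: measurable_funS mk.
- by move=> t /sub0/=; rewrite in_itv/= andbT; exact: k0.
apply: eq_integral => x; rewrite inE/= in_itv/= => /andP[x0 x1].
rewrite mulrC EFinM; congr (_ * _)%E; rewrite -integral_expRN_0x//.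
congr (integral _ _ _); apply/seteqP; split => t /=; rewrite !in_itv/=.
  by move=> [/andP[-> _] ->].
by move=> /andP[-> tx]; rewrite tx (le_trans tx x1).
Qed.

(** Integrability is part of the conclusion because it is what makes the
centering constant unique. *)
Lemma integrable_expRN_oriented_int :
  mu.-integrable `]0%R, +oo[ (EFin \o (fun y => expR (- y) * J y)) /\
  \int[mu]_(y in `]0%R, +oo[) (expR (- y) * J y) =
    \int[mu]_(t in `[1%R, +oo[) (expR (- t) * k t) -
    \int[mu]_(t in `]0%R, 1%R]) ((1 - expR (- t)) * k t).
Proof.
have i1 : mu.-integrable `[1%R, +oo[ (EFin \o (fun y => expR (- y) * J y)).
  apply: ge0_integrable => //.
  - apply/measurable_EFinP; apply: measurable_funM; first exact: mE.
    by apply: measurable_funS mJ.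
  - move=> y /=; rewrite in_itv/= andbT => y1; rewrite lee_fin mulr_ge0 ?expR_ge0//.
    by rewrite -J1; exact: oriented_int_nondecreasing.
  - rewrite /= integral_expRN_oriented_int_ge1.
    exact: integrable_lty ik1.
have i0N : mu.-integrable `]0%R, 1%R] (EFin \o (fun y => expR (- y) * - J y)).
  apply: ge0_integrable => //.
  - apply/measurable_EFinP.
    apply: measurable_funM; first exact: mE.
    by apply: measurableT_comp => //; apply: measurable_funS mJ.
  - move=> y /=; rewrite in_itv/= => /andP[y0 y1]; rewrite lee_fin mulr_ge0 ?expR_ge0//.
    by rewrite oppr_ge0 -J1; exact: oriented_int_nondecreasing.
  - rewrite /= integral_expRN_oriented_int_le1.
    exact: integrable_lty ik0.
have i0 : mu.-integrable `]0%R, 1%R] (EFin \o (fun y => expR (- y) * J y)).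
  rewrite (_ : (fun y => expR (- y) * J y) =
               (fun y => -1 * (expR (- y) * - J y))).
    exact: integrable_EFinZl.
  by apply/funext => y; rewrite mulrN mulN1r opprK.
have U : `]0%R, +oo[%classic = `]0%R, 1%R] `|` `]1%R, +oo[ :> set R.
  by rewrite -itv_bndbnd_setU// bnd_simp.
have i1o : mu.-integrable `]1%R, +oo[ (EFin \o (fun y => expR (- y) * J y)).
  apply: integrableS i1 => // x /=.
  by rewrite !in_itv/= !andbT; exact: ltW.
have dis : [disjoint `]0%R, 1%R]%classic & (`]1%R, +oo[ : set R)].
  apply/disj_setPS => y [/=]; rewrite 2!in_itv/= andbT => /andP[_ y1].
  by rewrite ltNge y1.
have i : mu.-integrable (`]0%R, 1%R] `|` `]1%R, +oo[) (EFin \o (fun y => expR (- y) * J y)).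
  exact: integrable_setU.
rewrite U; split => //; rewrite Rintegral_setU// addrC; congr (_ + _).
  rewrite Rintegral_itv_obnd_cbnd// /Rintegral.
  by rewrite integral_expRN_oriented_int_ge1.
rewrite -[LHS]opprK -[X in - X = _]mulN1r -RintegralZl//; congr (- _); rewrite /Rintegral.
rewrite -integral_expRN_oriented_int_le1; congr fine.
by apply: eq_integral => y _; rewrite mulrN mulN1r.
Qed.

End exponential_average.

(** * Laws with a prescribed inverse distribution function *)

Section quantile.
Context {R : realType}.
Notation mu := (@lebesgue_measure R).

(** The half-line and the segment have the same mass since the law does not
charge ]-oo, 0]; the lower and the upper bound on the distribution function
of an image law each use one of them. *)
Lemma exponential_law_exists : exists E : probability (measurableTypeR R) R,
  forall y : R, 0 < y -> E `]0, y]%classic = (1 - expR (- y))%:E /\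
                         E `]-oo, y]%classic = (1 - expR (- y))%:E.
Proof.
unshelve eexists (exponential_prob (1 : R) : probability _ R); first exact: ltr01.
move=> y y0 /=.
have E0y : exponential_prob (1 : R) `[0, y] = (1 - expR (- y))%:E.
  by rewrite exponential_prob_itv0c// mulN1r EFinB.
split.
  rewrite -E0y /exponential_prob integral_itv_obnd_cbnd//.
  apply/measurable_EFinP; apply: measurable_funS (measurable_exponential_pdf _) => //.
have EI A : exponential_prob (1 : R) A =
    (\int[mu]_(x in A `&` `[0%R, +oo[) (1 * expR (- 1 * x))%:E)%E.
  rewrite integral_mkcondr; apply: eq_integral => x _.
  by rewrite /exponential_pdf !patchE; case: ifP.
rewrite -E0y !EI.
congr (integral _ _ _); apply/seteqP; split => x /=; rewrite !in_itv/= !andbT.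
  by move=> [-> ->].
by move=> [/andP[_ ->] ->].
Qed.

(** The law is that of G(E), with E standard exponential.  For x >= G(y) the
event G(E) <= x contains 0 < E <= y.  For x < G(y), left continuity of G
gives z < y with x < G(z), and the event is contained in E <= z, of mass less
than 1 - e^{-y}. *)
Lemma inverse_df_law_exists (G : R -> R) :
  (forall y, 0 < y -> {for y, continuous G}) ->
  (forall a b, 0 < a -> a <= b -> G a <= G b) ->
  exists mu : probability R R, forall y, 0 < y ->
    inverse_df (fun x => mu `]-oo, x]%classic) (1 - expR (- y)) = G y.
Proof.
move=> cG ndG.
(* Nothing is known of G outside ]0, +oo[, a set of full exponential mass. *)
pose X : measurableTypeR R -> R := G \_ `]0, +oo[%classic.
have mX : measurable_fun setT X.
  apply: (measurable_restrictT G _).1 => //.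
  apply: open_continuous_measurable_fun; first exact: interval_open.
  by move=> y; rewrite inE/= in_itv/= andbT; exact: cG.
have XE y : 0 < y -> X y = G y by move=> y0; rewrite /X patchE mem_set//= in_itv/= y0.
have [E Ey] := exponential_law_exists.
pose X' : {mfun measurableTypeR R >-> R} := mfun_Sub (mem_set mX).
have mXx x : measurable (X @^-1` `]-oo, x]).
  by rewrite -[_ @^-1` _]setTI; exact: (mX measurableT).
exists (distribution E X') => y y0; rewrite /inverse_df.
suff -> : [set x | ((1 - expR (- y))%:E <= distribution E X' `]-oo, x]%classic)%E] =
    `[G y, +oo[%classic by rewrite inf_itv.
apply/seteqP; split => x; rewrite /= in_itv/= andbT /distribution /pushforward/=.
- move=> uE; rewrite leNgt; apply/negP => xGy.
  have [z [z0 zy xGz]] : exists z, [/\ 0 < z, z < y & x < G z].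
    have Gyx : \forall z \near y, x < G z.
      exact: cvgr_gt (cG y y0) _ xGy.
    near (y^'-) => z; exists z; split; near: z.
    + exact: nbhs_left_gt.
    + exact: nbhs_left_lt.
    + exact: cvg_at_left_filter Gyx.
  have : (E (X @^-1` `]-oo, x]) <= E `]-oo, z]%classic)%E.
    apply: le_measure; rewrite ?inE//.
    move=> t /=; rewrite !in_itv/=; have [//|zt] := leP t z.
    by rewrite XE 1?(lt_trans z0 zt)// leNgt (lt_le_trans xGz)// ndG// ltW.
  move=> /(le_trans uE); rewrite (Ey z z0).2 lee_fin lerD2l lerN2 ler_expR lerN2.
  by rewrite leNgt zy.
- move=> Gyx; rewrite -(Ey y y0).1; apply: le_measure; rewrite ?inE//.
  move=> t /=; rewrite !in_itv/= => /andP[t0 ty].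
  by rewrite XE// (le_trans _ Gyx)// ndG.
Unshelve. all: by end_near. Qed.

End quantile.

Section cdf_continuity.
Context {R : realType} {d : measure_display} {T : measurableType d}.
Variables (P : probability T R) (X : {RV P >-> R}).

(** If the distribution function F jumps at x by at least e, every level strictly
between F(x) - e and F(x) has x as its quantile, whereas G separates any two
levels. *)
Lemma cdf_continuous (G : R -> R) :
  (forall y, 0 < y -> inverse_df (cdf X) (1 - expR (- y)) = G y) ->
  (forall a b, 0 < a -> a < b -> G a < G b) ->
  continuous (cdf X).
Proof.
move=> XG incG x; apply/left_right_continuousP; split; last first.
  exact: cdf_right_continuous.
have Ff z : cdf X z = (fine (cdf X z))%:E by rewrite fineK// fin_num_measure.
pose F z := fine (cdf X z).
have ndF a b : a <= b -> F a <= F b.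
  by move=> ab; rewrite -lee_fin -!Ff; exact: cdf_nondecreasing.
have F0 z : 0 <= F z by rewrite -lee_fin -Ff; exact: cdf_ge0.
have F1 z : F z <= 1 by rewrite -lee_fin -Ff; exact: cdf_le1.
have key e : 0 < e -> exists2 z, z < x & F x - e < F z.
  move=> e0; apply/not_exists2P => Hz.
  have {}Hz z : z < x -> F z <= F x - e.
    by move=> zx; have [/(_ zx)//|/negP] := Hz z; rewrite -leNgt.
  (* Levels of the jump all have quantile x. *)
  have inv y : 0 < y -> F x - e < 1 - expR (- y) -> 1 - expR (- y) <= F x -> G y = x.
    move=> y0 ey yx; rewrite -XG// /inverse_df.
    suff -> : [set z | ((1 - expR (- y))%:E <= cdf X z)%E] = `[x, +oo[%classic.
      by rewrite inf_itv.
    apply/seteqP; split => z; rewrite /= in_itv/= andbT Ff lee_fin.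
      by move=> yz; rewrite leNgt; apply/negP => /Hz /(le_trans yz); rewrite leNgt ey.
    by move=> xz; rewrite (le_trans yx)// ndF.
  have ex0 : 0 <= F x - e by rewrite (le_trans (F0 (x - 1)))// Hz// ltrBlDr ltrDl.
  (* Two levels inside the jump, written as 1 - e^{-y} with y > 0. *)
  pose u1 := F x - e / 2; pose u2 := F x - e / 3.
  have u12 : u1 < u2 by rewrite /u1 /u2; lra.
  have u1e : F x - e < u1 by rewrite /u1; lra.
  have u2x : u2 < F x by rewrite /u2; lra.
  have u21 : u2 < 1 by rewrite (lt_le_trans u2x).
  pose y (u : R) := - ln (1 - u).
  have ey u : u < 1 -> 1 - expR (- y u) = u.
    by move=> u1'; rewrite /y opprK lnK ?posrE ?subr_gt0// opprB addrC subrK.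
  have y1 : 0 < y u1 by rewrite oppr_gt0 ln_lt0//; apply/andP; split; lra.
  have y12 : y u1 < y u2 by rewrite ltrN2 ltr_ln ?posrE; lra.
  have := incG _ _ y1 y12.
  rewrite (inv (y u1))// ?ey; [|lra..].
  by rewrite (inv (y u2)) ?ltxx// ?ey; lra.
rewrite Ff; apply/fine_cvgP; split.
  by apply: nearW => z; rewrite Ff.
apply/cvgrPdist_lt => e e0; have [z zx Fxz] := key e e0.
near=> t.
have zt : z <= t by near: t; exact: nbhs_left_ge.
have tx : t <= x by near: t; exact: nbhs_left_le.
rewrite /= ger0_norm ?subr_ge0 ?ndF//.
by have := ndF _ _ zt; rewrite -/(F x) -/(F t); lra.
Unshelve. all: by end_near. Qed.

End cdf_continuity.

(** * The function H_0 of a variable with a density *)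

Section phi_inverse_of_density.
Context {d : measure_display} {Omega : measurableType d} {R : realType}.
Context {P : probability Omega R} (T : {RV P >-> R}) (f : R -> R).
Hypothesis hf : is_density T f.
Notation mu := (@lebesgue_measure R).

Let f0 : forall x, 0 <= f x. Proof. by case: hf. Qed.
Let mf : measurable_fun setT f. Proof. by case: hf. Qed.

Lemma density_integrable : mu.-integrable setT (EFin \o f).
Proof.
case: hf => _ _ df; apply: ge0_integrable => //.
- exact/measurable_EFinP.
- by move=> x _; rewrite lee_fin.
- by rewrite /= -df//= probability_setT ltry.
Qed.

Let fiS (A : set (measurableTypeR R)) : measurable A -> mu.-integrable A (EFin \o f).
Proof. by move=> mA; apply: integrableS density_integrable. Qed.

Lemma fine_cdf_density x : fine (cdf T x) = \int[mu]_(t in `]-oo, x]) f t.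
Proof. by case: hf => _ _ df; rewrite /cdf df. Qed.

(** A law with a density has no atoms, so P(T < x) = P(T <= x). *)
Lemma fine_prob_lt_density x : fine (P [set w | T w < x]) = fine (cdf T x).
Proof.
case: hf => _ _ df; rewrite fine_cdf_density.
have -> : [set w | T w < x] = T @^-1` `]-oo, x[%classic.
  by apply/seteqP; split => w /=; rewrite in_itv.
rewrite -[P _]/(distribution P T _) df// integral_itv_bndo_bndc//.
by apply/measurable_EFinP; exact: measurable_funTS mf.
Qed.

Definition density_kernel (x : R) : R := expR x / x * f x.
Local Notation k := density_kernel.

Lemma density_kernel_ge0 x : 0 < x -> 0 <= k x.
Proof.
by move=> x0; rewrite /k mulr_ge0// divr_ge0 ?expR_ge0// ltW.
Qed.

Let mV : measurable_fun (`]0, +oo[%classic : set R) (fun x : R => x^-1).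
Proof.
apply: open_continuous_measurable_fun; first exact: interval_open.
move=> x; rewrite inE/= in_itv/= andbT => x0.
by apply: inv_continuous; rewrite gt_eqF.
Qed.

Let mh : measurable_fun (`]0, +oo[%classic : set R) (fun x : R => expR x / x).
Proof. by apply: measurable_funM => //; exact: measurable_funTS. Qed.

Lemma measurable_density_kernel :
  measurable_fun (`]0, +oo[%classic : set R) k.
Proof. by apply: measurable_funM => //; exact: measurable_funTS mf. Qed.

Lemma integrable_density_kernel a b : 0 < a ->
  mu.-integrable `[a, b] (EFin \o k).
Proof.
move=> a0; apply: (@integrable_EFinM_bounded _ _ _ _ _ _ _ (expR b / a)) => //.
- apply: measurable_funS mh => // x /=; rewrite !in_itv/= andbT => /andP[ax _].
  exact: lt_le_trans ax.
- move=> x /=; rewrite in_itv/= => /andP[ax xb].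
  have x0 := lt_le_trans a0 ax.
  rewrite divr_ge0 ?expR_ge0 ?(ltW x0)//=.
  by apply: ler_pM; rewrite ?expR_ge0 ?invr_ge0 ?ler_expR ?lef_pV2// ltW.
- exact: fiS.
Qed.

Lemma expRN_density_kernel t : 0 < t -> expR (- t) * k t = t^-1 * f t.
Proof.
move=> t0; rewrite expRN /k; have : expR t != 0 by rewrite gt_eqF ?expR_gt0.
by move=> e0; field; rewrite e0 gt_eqF.
Qed.

Lemma onem_expRN_density_kernel t : 0 < t ->
  (1 - expR (- t)) * k t = (expR t - 1) / t * f t.
Proof.
move=> t0; rewrite expRN /k; have : expR t != 0 by rewrite gt_eqF ?expR_gt0.
by move=> e0; field; rewrite e0 gt_eqF.
Qed.

Lemma integrable_density_ge1 :
  mu.-integrable `[1, +oo[ (EFin \o (fun t => t^-1 * f t)).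
Proof.
apply: (@integrable_EFinM_bounded _ _ _ _ _ _ _ 1) => //.
- apply: measurable_funS mV => // x /=; rewrite !in_itv/= !andbT.
  exact: lt_le_trans.
- move=> x /=; rewrite in_itv/= andbT => x1.
  by rewrite invr_ge0 invf_le1 ?(lt_le_trans _ x1)// (le_trans _ x1)/=.
- exact: fiS.
Qed.

(** The weight (e^t - 1) / t is at most e on ]0, 1], because
e^t (1 - t) <= e^t e^{-t} = 1. *)
Lemma integrable_density_le1 :
  mu.-integrable `]0, 1] (EFin \o (fun t => (expR t - 1) / t * f t)).
Proof.
apply: (@integrable_EFinM_bounded _ _ _ _ _ _ _ (expR 1)) => //.
- apply: measurable_funM.
    by apply: measurable_funB => //; exact: measurable_funTS.
  by apply: measurable_funS mV => //; exact: subset_itvl.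
- move=> x /=; rewrite in_itv/= => /andP[x0 x1].
  apply/andP; split.
    by rewrite divr_ge0 ?(ltW x0)// subr_ge0 -expR0 ler_expR ltW.
  rewrite ler_pdivrMr//.
  have ex : expR x * (1 - x) <= 1.
    have := expR_ge1Dx (- x); rewrite -(ler_pM2l (expR_gt0 x)) => /le_trans; apply.
    by rewrite -expRD subrr expR0.
  have : expR x * x <= expR 1 * x by rewrite ler_pM2r// ler_expR.
  by move: ex; rewrite mulrBr mulr1; lra.
- exact: fiS.
Qed.

Local Notation J := (fun y => oriented_int 1 y k).
Let F1 := fine (cdf T 1).
Let K := \int[mu]_(t in `[1, +oo[) (t^-1 * f t) -
         \int[mu]_(t in `[0, 1]) ((expR t - 1) / t * f t).

Let ik1 : mu.-integrable `[1, +oo[ (EFin \o (fun t => expR (- t) * k t)).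
Proof.
apply: eq_integrable integrable_density_ge1 => // t.
rewrite inE/= in_itv/= andbT => t1.
by rewrite /= expRN_density_kernel// (lt_le_trans ltr01).
Qed.

Let ik0 : mu.-integrable `]0, 1] (EFin \o (fun t => (1 - expR (- t)) * k t)).
Proof.
apply: eq_integrable integrable_density_le1 => // t.
rewrite inE/= in_itv/= => /andP[t0 _].
by rewrite /= onem_expRN_density_kernel.
Qed.

Let KE : K = \int[mu]_(t in `[1, +oo[) (expR (- t) * k t) -
    \int[mu]_(t in `]0, 1]) ((1 - expR (- t)) * k t).
Proof.
rewrite /K -(Rintegral_itv_obnd_cbnd integrable_density_le1).
congr (_ - _); apply: eq_Rintegral => t; rewrite inE/= in_itv/=.
  by rewrite andbT => t1; rewrite expRN_density_kernel// (lt_le_trans ltr01).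
by move=> /andP[t0 _]; rewrite onem_expRN_density_kernel.
Qed.

(** Used with c = 1 to the right of 1 and with c = -1 to the left, the sign of
the derivative of e^x / x being that of x - 1. *)
Lemma by_parts_density (c a b : R) : 0 < a -> a <= b ->
  (forall x, a <= x <= b -> 0 <= c * (x - 1)) ->
  \int[mu]_(x in `[a, b]) (c * ((x - 1) / x ^+ 2 * expR x) * fine (cdf T x)) =
  c * (expR b / b) * fine (cdf T b) - c * (expR a / a) * fine (cdf T a)
  - \int[mu]_(x in `[a, b]) (c * k x).
Proof.
move=> a0 ab cpos.
have aP x : a <= x -> 0 < x by exact: lt_le_trans.
rewrite !fine_cdf_density; under eq_Rintegral do rewrite fine_cdf_density.
rewrite (@Rintegral_by_parts_ge0 _ f (fun x => c * (expR x / x))) => //.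
- by congr (_ - _); apply: eq_Rintegral => x _; rewrite -mulrA.
- exact: density_integrable.
- apply: measurable_funM => //.
  have mw : measurable_fun (`]0, +oo[%classic : set R)
      (fun x : R => (x - 1) / x ^+ 2 * expR x).
    apply: open_continuous_measurable_fun; first exact: interval_open.
    by move=> x; rewrite inE/= in_itv/= andbT; exact: continuous_expRV_deriv.
  apply: measurable_funS mw => // x /=; rewrite !in_itv/= andbT => /andP[/aP//].
- move=> x /[dup] /cpos cx /andP[ax _]; rewrite mulrA mulr_ge0 ?expR_ge0//.
  by rewrite mulrA divr_ge0// exprn_ge0// ltW// aP.
- by move=> t ta tb; rewrite integral_expRV// aP.
- rewrite (_ : _ \* f = (fun x => c * k x)); last first.
    by apply/funext => x; rewrite /= -mulrA.
  by apply: integrable_EFinZl => //; exact: integrable_density_kernel.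
Qed.

(** After the integration by parts the boundary terms at y cancel, leaving the one
at 1, which is e F(1). *)
Lemma H0_uncenteredE y : 0 < y -> H0_uncentered T y = expR 1 * F1 + J y.
Proof.
move=> y0; rewrite /H0_uncentered fine_prob_lt_density.
rewrite /oriented_int; case: ifPn => [y1|]; last rewrite -ltNge => y1.
  rewrite (_ : \int[mu]_(x in `[1, y]) _ = \int[mu]_(x in `[1, y])
      (1 * ((x - 1) / x ^+ 2 * expR x) * fine (cdf T x))); last first.
    by apply: eq_Rintegral => x _; rewrite mul1r.
  rewrite by_parts_density// => [|x /andP[x1 _]]; last by rewrite mul1r subr_ge0.
  rewrite RintegralZl//; last exact: integrable_density_kernel.
  by rewrite /F1 divr1; ring.
have cpos x : y <= x <= 1 -> 0 <= -1 * (x - 1).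
  by move=> /andP[_ x1]; rewrite mulN1r opprB subr_ge0.
have := @by_parts_density (-1) y 1 y0 (ltW y1) cpos.
rewrite RintegralZl//; last exact: integrable_density_kernel.
rewrite (_ : \int[mu]_(x in `[y, 1])
   (-1 * ((x - 1) / x ^+ 2 * expR x) * fine (cdf T x)) =
   - \int[mu]_(x in `[y, 1]) ((x - 1) / x ^+ 2 * expR x * fine (cdf T x))); last first.
  (* The integrand multiplied by -1 is nonnegative, so the sign can be moved
     out without knowing that the integral is finite. *)
  have := @integral_ge0N _ _ _ mu `[y, 1]%classic (fun x =>
    (-1 * ((x - 1) / x ^+ 2 * expR x) * fine (cdf T x))%:E).
  rewrite /Rintegral => H; apply/eqP; rewrite -eqr_oppLR -fineN; apply/eqP.
  rewrite -H; last first.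
    move=> x; rewrite /= in_itv/= => /[dup] /cpos cx /andP[yx _].
    rewrite lee_fin mulr_ge0 ?fine_ge0//.
    by rewrite 2!mulrA mulr_ge0 ?expR_ge0// divr_ge0// exprn_ge0// (le_trans (ltW y0)).
  congr fine; apply: eq_integral => x _.
  by rewrite -EFinN !mulN1r mulNr opprK.
move=> /eqP; rewrite eqr_oppLR => /eqP ->.
by rewrite /F1 divr1; ring.
Qed.

(** The exponential law has total mass 1, so the centered integral is affine in c
with slope -1. *)
Lemma is_centeringP c : is_centering T c <-> c = expR 1 * F1 + K.
Proof.
have [iJ intJ] := integrable_expRN_oriented_int density_kernel_ge0
  integrable_density_kernel measurable_density_kernel ik1 ik0.
have iE : mu.-integrable `]0, +oo[ (EFin \o (fun y : R => expR (- y))).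
  apply: ge0_integrable => //.
  - apply/measurable_EFinP; apply: measurable_funTS.
    by apply: continuous_measurable_fun; exact: continuous_expRN.
  - by move=> y _; rewrite lee_fin expR_ge0.
  - rewrite /= integral_itv_obnd_cbnd ?integral_expRN_bndy ?ltry//.
    apply/measurable_EFinP; apply: measurable_funTS.
    by apply: continuous_measurable_fun; exact: continuous_expRN.
have intE : \int[mu]_(y in `]0, +oo[) expR (- y) = 1.
  rewrite Rintegral_itv_obnd_cbnd// /Rintegral integral_expRN_bndy.
  by rewrite oppr0 expR0.
set e := c - expR 1 * F1.
have EI : (\int[mu]_(y in `]0%R, +oo[) (expR (- y) * (H0_uncentered T y - c))%:E =
  (K - e)%:E)%E.
  transitivity (\int[mu]_(y in `]0%R, +oo[) (expR (- y) * J y - e * expR (- y))%:E)%E.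
    apply: eq_integral => y; rewrite inE/= in_itv/= andbT => y0.
    by rewrite H0_uncenteredE// /e; congr EFin; ring.
  rewrite integralB_EFin//; last exact: integrable_EFinZl.
  rewrite -[LHS]fineK; last first.
    rewrite fin_numB; apply/andP; split; apply: integrable_fin_num => //.
    exact: integrable_EFinZl.
  rewrite fineB; try by apply: integrable_fin_num => //; exact: integrable_EFinZl.
  by rewrite -!/(Rintegral _ _ _) RintegralZl// intE mulr1 intJ KE.
rewrite /is_centering EI; split.
  by move=> [] /eqP; rewrite subr_eq0 => /eqP ->; rewrite /e addrC subrK.
by rewrite /e => ->; rewrite [_ + K]addrC addrK subrr.
Qed.

Lemma H0_density y : 0 < y -> H0 T y = J y - K.
Proof.
move=> y0; rewrite /H0 H0_uncenteredE//.
have /is_centeringP : is_centering T (centering T).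
  by apply: getPex; exists (expR 1 * F1 + K); exact/is_centeringP.
by move=> ->; rewrite opprD addrACA subrr add0r.
Qed.

End phi_inverse_of_density.

Theorem corollary2p1 (R : realType)
    (d : measure_display) (Omega : measurableType d) (P : probability Omega R)
    (T : {RV P >-> R}) (f : R -> R)
    (d' : measure_display) (Omega' : measurableType d')
    (Q : probability Omega' R) (X0 : {RV Q >-> R})
    (hT : class_T T) (hf : is_density T f) (hX0 : has_law X0 (phi_inv T)) :
  (forall y : R, 0 < y ->
     inverse_df (cdf X0) (1 - expR (- y)) =
       oriented_int 1 y (fun x => expR x / x * f x)
       + \int[lebesgue_measure]_(t in `[0, 1]) ((expR t - 1) / t * f t)
       - \int[lebesgue_measure]_(t in `[1, +oo[) (t^-1 * f t)) /\
  ({ae lebesgue_measure, forall y : R, 0 < y -> 0 < f y} ->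
     continuous (cdf X0)).
Proof.
have ik := integrable_density_kernel hf.
have k0 := density_kernel_ge0 hf.
(* K is the mean of the oriented primitive under the standard exponential law. *)
pose K := \int[lebesgue_measure]_(t in `[1, +oo[) (t^-1 * f t) -
  \int[lebesgue_measure]_(t in `[0, 1]) ((expR t - 1) / t * f t).
pose G y := oriented_int 1 y (density_kernel f) - K.
have [mu muG] : exists mu : probability R R, forall y, 0 < y ->
    inverse_df (fun x => mu `]-oo, x]%classic) (1 - expR (- y)) = G y.
  apply: inverse_df_law_exists => [y y0|a b a0 ab].
    by apply: cvgB; [exact: oriented_int_continuous|exact: cvg_cst].
  by rewrite lerD2r; exact: oriented_int_nondecreasing.
have quantileX0 y : 0 < y -> inverse_df (cdf X0) (1 - expR (- y)) = G y.
  have cdfE : cdf X0 = (fun x => phi_inv T `]-oo, x]%classic).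
    by apply/funext => x; rewrite /cdf hX0.
  move=> y0; rewrite cdfE [RHS](_ : _ = H0 T y); last first.
    by rewrite (H0_density hf).
  move: y y0; apply: (@getPex _ [set nu : probability R R | forall y, 0 < y ->
    inverse_df (fun x => nu `]-oo, x]%classic) (1 - expR (- y)) = H0 T y]).
  (* phi_inv T is chosen among the laws with this inverse distribution
     function, and mu is one of them. *)
  by exists mu => y y0; rewrite muG// (H0_density hf).
split=> [y y0|fpos]; first by rewrite quantileX0// /G /K opprB addrA.
apply: cdf_continuous quantileX0 _ => a b a0 ab.
rewrite ltrD2r; apply: oriented_int_increasing => //.
apply: (@filterS _ _ (ae_filter_ringOfSetsType lebesgue_measure) _ _ _ fpos).
by move=> x fx x0; rewrite mulr_gt0 ?divr_gt0 ?expR_gt0 ?fx.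
Qed.
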